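(* Let $\Omega$ be the space of all simplicial subcomplexes of $\Delta_{\mathbb N}$, with the metric $d$ described below, and let $\mathcal R\subseteq\Omega$ be the set of complexes isomorphic to the Rado complex. Then $\mathcal R$ is residual in $\Omega$ (its complement is a countable union of nowhere dense sets), and therefore $\mathcal R$ is dense in $\Omega$.
   Context: $\Delta_{\mathbb N}$ is the simplicial complex with vertex set $\mathbb N=\{1,2,\dots\}$ whose simplexes are all finite nonempty subsets of $\mathbb N$; $\Delta_n\subseteq\Delta_{\mathbb N}$ is the full simplex on $\{1,\dots,n\}$. $\Omega$ is the set of all subcomplexes $X\subseteq\Delta_{\mathbb N}$. For $X\in\Omega$ put $X_n=X\cap\Delta_n$; for $X,Y\in\Omega$ let $h(X,Y)=\max\{n: X_n=Y_n\}$ (with $\Delta_0=\emptyset$, and $h=\infty$ if $X=Y$), and $d(X,Y)=\exp(-h(X,Y))$. This metric induces the inverse limit topology $\Omega=\varprojlim\Omega_n$, where $\Omega_n$ is the finite discrete set of subcomplexes of $\Delta_n$; $\Omega$ is compact. For $U\subseteq V(X)$, $X_U$ is the induced subcomplex; $\mathrm{Lk}_X(v)$ is the subcomplex of simplexes $\sigma$ with $v\notin\sigma$, $\sigma\cup\{v\}\in X$. The Rado complex is the unique (up to isomorphism) simplicial complex with a countable vertex set which is nonempty and satisfies: for every finite $U\subseteq V(X)$ and every subcomplex $A\subseteq X_U$ there exists $v\in V(X)\setminus U$ with $\mathrm{Lk}_X(v)\cap X_U=A$. *)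

(* Defs.v *)
From HB Require Import structures.
From mathcomp Require Import all_boot all_order all_algebra.
From mathcomp Require Import finmap.
From mathcomp Require Import all_classical all_reals all_analysis.

Set Implicit Arguments.
Unset Strict Implicit.
Unset Printing Implicit Defensive.

Import Order.TTheory GRing.Theory Num.Theory.

Local Open Scope classical_set_scope.
Local Open Scope ring_scope.

Section complexes.
Context {V : choiceType}.
Implicit Types (X A : set {fset V}) (U : set V) (s t : {fset V}) (v : V).

(* A complex is identified with its set of simplexes, which are nonempty; the
   complex with no simplex at all is allowed. *)
Definition is_complex X : Prop :=
  (forall s, X s -> s != fset0) /\
  (forall s t, X s -> (t `<=` s)%fset -> t != fset0 -> X t).

Definition subcomplex A X : Prop := is_complex A /\ A `<=` X.

Definition full_simplex U : set {fset V} :=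
  [set s | s != fset0 /\ [set` s] `<=` U].

Definition vertices X : set V := [set v | X [fset v]%fset].

Definition induced_subcomplex X U : set {fset V} := X `&` full_simplex U.

Definition link X v : set {fset V} :=
  [set s | [/\ X s, v \notin s & X (v |` s)%fset]].

Definition is_rado X : Prop :=
  [/\ is_complex X, countable (vertices X), X !=set0 &
    forall U A, finite_set U -> U `<=` vertices X ->
      subcomplex A (induced_subcomplex X U) ->
      exists v, [/\ vertices X v, ~ U v & link X v `&` induced_subcomplex X U = A]].

End complexes.

(* The ambient types are pointed so that a total function V -> W can represent
   a map of vertex sets even when these are empty. *)
Definition isomorphic (V W : pointedType)
    (X : set {fset V}) (Y : set {fset W}) : Prop :=
  exists f : V -> W, set_bij (vertices X) (vertices Y) f /\
    forall s : {fset V}, [set` s] `<=` vertices X ->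
      (X s <-> Y [fset f x | x in s]%fset).

(* "The" Rado complex: it has the defining property, and every complex with
   this property is isomorphic to it. *)
Definition is_the_rado_complex (V : pointedType) (Z : set {fset V}) : Prop :=
  is_rado Z /\
  forall (W : pointedType) (Y : set {fset W}), is_rado Y -> isomorphic Y Z.

Section category.
Context {T : topologicalType}.

Definition nowhere_dense (A : set T) : Prop := interior (closure A) = set0.

Definition residual (A : set T) : Prop :=
  exists F : nat -> set T,
    (forall n, nowhere_dense (F n)) /\ ~` A = \bigcup_n F n.

End category.

Definition DeltaN : set {fset nat} := full_simplex [set v : nat | (1 <= v)%N].

Definition Delta (n : nat) : set {fset nat} :=
  full_simplex [set v : nat | (1 <= v <= n)%N].

(* R plays no role in the carrier; it only fixes the field in which the
   distance takes its values. *)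
Record Omega (R : realType) := MkOmega {
  simplexes :> set {fset nat};
  simplexesP : subcomplex simplexes DeltaN }.

HB.instance Definition _ (R : realType) := gen_eqMixin (Omega R).
HB.instance Definition _ (R : realType) := gen_choiceMixin (Omega R).

Section metric.
Context {R : realType}.
Implicit Types X Y Z : Omega R.

Definition truncation X (n : nat) : set {fset nat} := X `&` Delta n.

(* The set of n is finite unless X = Y, in which case the value is +oo; see
   agreement_max and agreementxx below. *)
Definition agreement X Y : \bar R :=
  ereal_sup [set n%:R%:E | n in [set n | truncation X n = truncation Y n]].

Definition omega_dist X Y : R := fine (expeR (- agreement X Y)%E).

Lemma Omega_eq X Y : simplexes X = simplexes Y -> X = Y.
Proof.
case: X Y => X PX [Y PY] /= XY; rewrite XY in PX *.
by congr MkOmega; exact: Prop_irrelevance.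
Qed.

Lemma truncation_le X Y m n : (m <= n)%N ->
  truncation X n = truncation Y n -> truncation X m = truncation Y m.
Proof.
move=> mn XY.
have sub : Delta m `<=` Delta n.
  move=> s [s0 sm]; split => // v /sm /= /andP[-> vm].
  exact: leq_trans vm mn.
have E Z : truncation Z m = truncation Z n `&` Delta m.
  by rewrite /truncation -setIA (setIidr sub).
by rewrite !E XY.
Qed.

Lemma truncation_inj X Y :
  (forall n, truncation X n = truncation Y n) -> X = Y.
Proof.
move=> XY; apply: Omega_eq.
have key (A B : Omega R) : (forall n, truncation A n = truncation B n) ->
    simplexes A `<=` simplexes B.
  move=> AB s As; have [s0 s1] := (simplexesP A).2 _ As.
  suff : truncation B (\max_(v <- s) v) s by case.
  rewrite -AB; split => //; split => // v vs /=.
  by rewrite (s1 _ vs)/= (@leq_bigmax_seq _ _ _ (fun v => v)).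
by apply/seteqP; split; apply: key.
Qed.

Lemma le_agreement X Y n : truncation X n = truncation Y n ->
  (n%:R%:E <= agreement X Y)%E.
Proof. by move=> XY; apply: ereal_sup_ubound; exists n. Qed.

Lemma agreementxx X : agreement X X = +oo%E.
Proof.
apply: eq_infty => r.
apply: (@le_trans _ _ (Num.truncn `|r|).+1%:R%:E); last exact: le_agreement.
by rewrite lee_fin ltW// (le_lt_trans (ler_norm _))// truncnS_gt.
Qed.

Lemma agreement_le X Y n : truncation X n.+1 <> truncation Y n.+1 ->
  (agreement X Y <= n%:R%:E)%E.
Proof.
move=> XY; apply: ge_ereal_sup => _ [m /= mXY <-].
rewrite lee_fin ler_nat leqNgt; apply/negP => nm.
exact/XY/(truncation_le nm).
Qed.

Lemma agreement_max X Y : X <> Y ->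
  exists n : nat, [/\ agreement X Y = n%:R%:E,
    truncation X n = truncation Y n &
    forall m, truncation X m = truncation Y m -> (m <= n)%N].
Proof.
move=> XY.
have /existsNP ex : ~ forall n, truncation X n = truncation Y n.
  by move/truncation_inj.
have ex' : exists n, `[< truncation X n <> truncation Y n >].
  by case: ex => n /asboolP; exists n.
case: (ex_minnP ex') => -[|n] /asboolP nXY nmin.
  by exfalso; apply: nXY; apply/seteqP; split => s [_ [s0 /= s1]];
    case/fset0Pn: s0 => v /s1 /=; case: v.
have tn : truncation X n = truncation Y n.
  by apply: contrapT => /asboolP /nmin; rewrite ltnn.
exists n; split => //.
  by apply/eqP; rewrite eq_le agreement_le//= le_agreement.
move=> m mXY; rewrite leqNgt; apply/negP => nm.
exact/nXY/(truncation_le nm).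
Qed.

Lemma omega_distxx X : omega_dist X X = 0.
Proof. by rewrite /omega_dist agreementxx. Qed.

Lemma omega_distE X Y n : agreement X Y = n%:R%:E ->
  omega_dist X Y = expR (- n%:R).
Proof. by rewrite /omega_dist => ->. Qed.

Lemma omega_dist_ge0 X Y : 0 <= omega_dist X Y.
Proof. by rewrite /omega_dist fine_ge0// expeR_ge0. Qed.

Lemma omega_dist_positivity X Y : omega_dist X Y = 0 -> X = Y.
Proof.
move=> d0; apply: contrapT => /agreement_max[n [/omega_distE dn _ _]].
by have := expR_gt0 (- n%:R : R); rewrite -dn d0 ltxx.
Qed.

Lemma omega_dist_sym X Y : omega_dist X Y = omega_dist Y X.
Proof.
rewrite /omega_dist /agreement; congr (fine (expeR (- ereal_sup (_ @` _))%E)).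
by apply/seteqP; split => n /=.
Qed.

Lemma omega_dist_ge X Y n : truncation X n.+1 <> truncation Y n.+1 ->
  expR (- n%:R) <= omega_dist X Y.
Proof.
move=> nXY; have XY : X <> Y by move=> XY; apply: nXY; rewrite XY.
have [m [mE _ _]] := agreement_max XY; rewrite (omega_distE mE).
by rewrite ler_expR lerN2 -lee_fin -mE agreement_le.
Qed.

Lemma omega_dist_triangle Y X Z :
  omega_dist X Z <= omega_dist X Y + omega_dist Y Z.
Proof.
have [->|/agreement_max[n [/omega_distE -> _ nmax]]] := pselect (X = Z).
  by rewrite omega_distxx addr_ge0 ?omega_dist_ge0.
have [XY|XY] := pselect (truncation X n.+1 = truncation Y n.+1).
  have YZ : truncation Y n.+1 <> truncation Z n.+1.
    by move=> YZ; have := nmax n.+1; rewrite XY YZ ltnn => /(_ erefl).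
  by rewrite (le_trans (omega_dist_ge YZ))// lerDr omega_dist_ge0.
by rewrite (le_trans (omega_dist_ge XY))// lerDl omega_dist_ge0.
Qed.

End metric.

HB.instance Definition _ (R : realType) := @isMetric.Build R (Omega R)
  omega_dist omega_distxx omega_dist_positivity omega_dist_sym
  omega_dist_triangle.

Definition rado_class (R : realType) : set (Omega R) :=
  [set X | exists (V : pointedType) (Z : set {fset V}),
    is_the_rado_complex Z /\ isomorphic (simplexes X) Z].
Arguments rado_class : clear implicits.

(* Main.v *)
(**
  A complex in [Omega] fails to be Rado exactly when some extension problem
  [(U, A)], with [U] a finite set of vertices and [A] a subcomplex of [X_U], has
  no solution in it. There are countably many such problems, and each one is
  unsolved only on a nowhere dense set: a complex can be altered beyond any given
  truncation level by adding a vertex with link [A], and the new complex solves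
  [(U, A)] together with its whole neighbourhood. Density follows as in Baire's
  theorem. Back-and-forth shows that all Rado complexes are isomorphic, so each
  of them is the Rado complex.
*)
Require Import Defs.
From mathcomp Require Import all_boot all_order all_algebra.
From mathcomp Require Import finmap.
From mathcomp Require Import all_classical all_reals all_analysis.

Set Implicit Arguments.
Unset Strict Implicit.
Unset Printing Implicit Defensive.

Import Order.TTheory GRing.Theory Num.Theory.

Local Open Scope classical_set_scope.

(** * Uniqueness of the Rado complex by back-and-forth *)

(** The relation [S] depends on the stage, so that stage [k] can deal with the [k]-th task: a vertex
    to be matched, or a set to be avoided. *)
Lemma dependent_choice_inv (T : Type) (P : T -> Prop) (S : nat -> T -> T -> Prop)
    (x0 : T) :
  P x0 -> (forall k x, P x -> exists2 y, P y & S k x y) ->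
  exists u : nat -> T,
    [/\ u 0 = x0, forall k, P (u k) & forall k, S k (u k) (u k.+1)].
Proof.
move=> Px0 step.
have /choice[g gP] : forall kx : nat * T,
    exists y, P kx.2 -> P y /\ S kx.1 kx.2 y.
  move=> [k x]; have [Px|nPx] := pselect (P x); last by exists x.
  by have [y Py Sy] := step k x Px; exists y.
pose u := fix u k := if k is k'.+1 then g (k', u k') else x0.
have Pu k : P (u k) by elim: k => //= k /(gP (k, _))[].
by exists u; split => // k; have [] := gP (k, u k) (Pu k).
Qed.

(* A finite set [p] of indices, read as the set of pairs [(f i, g i)], is the
   graph of an isomorphism between induced subcomplexes. Keeping the two
   projections abstract makes the notion symmetric by exchanging them. *)
Definition partial_iso (I V W : choiceType) (f : I -> V) (g : I -> W)
    (X : set {fset V}) (Y : set {fset W}) (p : {fset I}) : Prop :=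
  [/\ {in p, forall i, vertices X (f i) /\ vertices Y (g i)},
      {in p &, forall i j, f i = f j <-> g i = g j} &
      forall t : {fset I}, (t `<=` p)%fset ->
        X [fset f i | i in t]%fset <-> Y [fset g i | i in t]%fset].

Lemma partial_isoC (I V W : choiceType) (f : I -> V) (g : I -> W) X Y p :
  partial_iso f g X Y p -> partial_iso g f Y X p.
Proof.
case=> vp ip sp; split=> [i /vp[]|i j ip' jp|t /sp ->] //.
by rewrite ip.
Qed.

Lemma partial_iso0 (I V W : choiceType) (f : I -> V) (g : I -> W) X Y :
  is_complex X -> is_complex Y -> partial_iso f g X Y fset0.
Proof.
move=> [X0 _] [Y0 _]; split=> // t; rewrite fsubset0 => /eqP ->.
by rewrite !imfset0; split => [/X0|/Y0]; rewrite eqxx.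
Qed.

(** The forth step: the extension property of [Y] provides a [w] whose link over the range of [p]
    copies that of [v] over its domain, and [(v, w)] is added to [p]. Exchanging [f] and [g] turns
    it into the back step. *)
Lemma partial_iso_extend (I V W : choiceType) (f : I -> V) (g : I -> W)
    (mk : V -> W -> I) (X : set {fset V}) (Y : set {fset W}) p v :
  (forall v w, f (mk v w) = v) -> (forall v w, g (mk v w) = w) ->
  is_complex X -> is_rado Y -> partial_iso f g X Y p -> vertices X v ->
  exists q : {fset I}, [/\ partial_iso f g X Y q, (p `<=` q)%fset &
    v \in [fset f i | i in q]%fset].
Proof.
move=> fmk gmk [X0 Xdown] [[Y0 Ydown] _ _ Yext] pp Xv.
have [vp|vNp] := boolP (v \in [fset f i | i in p]%fset); first by exists p.
have [pV pinj pXY] := pp.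
pose pre (r : {fset W}) := [fset i in p | g i \in r]%fset.
have prep r : (pre r `<=` p)%fset by apply/fsubsetP => i; rewrite !inE => /andP[].
(* [A] is the link of [v] within the domain of [p], carried over to [Y] along [p]. *)
pose A : set {fset W} := [set r | [/\ r != fset0,
  (r `<=` [fset g i | i in p])%fset & X (v |` [fset f i | i in pre r])%fset]].
have preK (r : {fset W}) : (r `<=` [fset g i | i in p])%fset ->
    [fset g i | i in pre r]%fset = r.
  move=> /fsubsetP rp; apply/fsetP => w; apply/imfsetP/idP => /=.
    by move=> [i]; rewrite !inE => /andP[_ ir] ->.
  move=> wr; have /imfsetP[i /= ip wE] := rp _ wr.
  by exists i => //; rewrite !inE ip -wE.
have imK t : (t `<=` p)%fset ->
    [fset f i | i in pre [fset g i | i in t]]%fset = [fset f i | i in t]%fset.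
  move=> /fsubsetP tp; apply/fsetP => x; apply/imfsetP/imfsetP => /= -[i].
    rewrite !inE => /andP[ip /imfsetP[j /= jt gij]] ->.
    by exists j => //; apply/pinj => //; exact: tp.
  by move=> it ->; exists i => //; rewrite !inE tp//=; apply: in_imfset.
have im0 (t : {fset I}) (T : choiceType) (h : I -> T) : t != fset0 ->
    [fset h i | i in t]%fset != fset0.
  by case/fset0Pn => i it; apply/fset0Pn; exists (h i); exact: in_imfset.
have Acomplex : subcomplex A
    (induced_subcomplex Y [set` [fset g i | i in p]%fset]).
  split.
    split=> [r []//|r r' [r0 rp Xr] r'r r'0]; split => //.
      exact: fsubset_trans rp.
    apply: Xdown Xr _ _; last by apply/fset0Pn; exists v; rewrite !inE eqxx.
    apply/fsetUS/fsubsetP => _ /imfsetP[i /= ir' ->]; apply: in_imfset.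
    by move: ir'; rewrite !inE => /andP[-> /(fsubsetP r'r)].
  move=> r [r0 rp Xr]; split; last by split => // w /(fsubsetP rp).
  rewrite -(preK r rp); apply/pXY => //.
  apply: Xdown Xr _ _; first exact: fsubsetUr.
  by apply: im0; apply: contraNN r0 => /eqP pr0; rewrite -(preK r rp) pr0 imfset0.
have [|w [Yw wNp linkE]] := Yext _ _ (finite_fset _) _ Acomplex.
  by move=> _ /imfsetP[i /= /pV[_ ?] ->].
have fNp i : i \in p -> f i <> v.
  by move=> ip fiv; move/negP: vNp; apply; rewrite -fiv; exact: in_imfset.
have gNp i : i \in p -> g i <> w.
  by move=> ip giw; apply: wNp; rewrite -giw; exact: in_imfset.
exists (mk v w |` p)%fset; split; last 2 first.
- exact: fsubsetUr.
- by apply/imfsetP; exists (mk v w) => //=; rewrite !inE eqxx.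
split=> [i|i j|t tq].
- by rewrite !inE => /orP[/eqP ->|/pV//]; rewrite fmk gmk.
- rewrite !inE => /orP[/eqP ->|ip] /orP[/eqP ->|jp] //; last exact: pinj.
  + by rewrite fmk gmk; split => /esym; [move/fNp|move/gNp] => /(_ jp).
  + by rewrite fmk gmk; split; [move/fNp|move/gNp] => /(_ ip).
have [it|itN] := boolP (mk v w \in t); last first.
  apply: pXY; apply/fsubsetP => i it.
  move: (fsubsetP tq _ it); rewrite !inE => /orP[/eqP iE|//].
  by rewrite iE (negbTE itN) in it.
(* With the new pair split off, membership on either side says that the rest lies in the link of
   [v], respectively of [w]. *)
pose t0 := (t `\ mk v w)%fset.
have t0p : (t0 `<=` p)%fset by rewrite fsubDset.
have tE : t = (mk v w |` t0)%fset by rewrite fsetD1K.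
rewrite tE !imfsetU !imfset_fset1 fmk gmk.
have [->|t00] := eqVneq t0 fset0; first by rewrite !imfset0 !fsetU0.
have gt0p : ([fset g i | i in t0] `<=` [fset g i | i in p])%fset.
  by apply: subset_imfset => i; exact: (fsubsetP t0p).
rewrite -(imK t0 t0p).
split=> [Xt|Yt].
  have : A [fset g i | i in t0]%fset by split => //; exact: im0.
  by rewrite -linkE => -[[]].
suff : A [fset g i | i in t0]%fset by case.
have Yt0 : Y [fset g i | i in t0]%fset.
  by apply: Ydown Yt _ _; [exact: fsubsetUr|exact: im0].
rewrite -linkE; split; last first.
  by split => //; split; [exact: im0|move=> x /(fsubsetP gt0p)].
split => //; apply/imfsetP => -[i /= /(fsubsetP t0p) ip /esym].
exact: gNp.
Qed.

(** Stage [k] of an increasing chain of finite partial isomorphisms takes in the vertices of code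
    [k] on both sides; the union of the chain is the graph of a bijection. *)
Lemma rado_isomorphic (V W : pointedType) (X : set {fset V}) (Y : set {fset W}) :
  is_rado X -> is_rado Y -> isomorphic X Y.
Proof.
move=> RX RY; have [cX ctX _ _] := RX; have [cY ctY _ _] := RY.
have /countable_injP[codeX codeX_inj] := ctX.
have /countable_injP[codeY codeY_inj] := ctY.
pose iso := partial_iso (@fst V W) snd X Y.
have [||u [_ uiso uS]] := @dependent_choice_inv {fset V * W} iso
    (fun k p q => [/\ (p `<=` q)%fset,
      forall v, vertices X v -> codeX v = k -> v \in [fset i.1 | i in q]%fset &
      forall w, vertices Y w -> codeY w = k -> w \in [fset i.2 | i in q]%fset])
    fset0.
- exact: partial_iso0.
- move=> k p isop.
  have [q [isoq pq qX]] : exists q : {fset V * W}, [/\ iso q, (p `<=` q)%fset &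
      forall v, vertices X v -> codeX v = k -> v \in [fset i.1 | i in q]%fset].
    have [[v [Xv vk]]|noX] := pselect (exists v, vertices X v /\ codeX v = k).
      have [//|//|q [isoq pq vq]] :=
        @partial_iso_extend _ _ _ fst snd pair _ _ _ _ _ _ cX RY isop Xv.
      exists q; split => // v' Xv' v'k.
      suff -> : v' = v by [].
      by apply: codeX_inj; rewrite ?inE// vk.
    by exists p; split => // v Xv vk; exfalso; apply: noX; exists v.
  have [r [isor qr rY]] : exists r : {fset V * W}, [/\ iso r, (q `<=` r)%fset &
      forall w, vertices Y w -> codeY w = k -> w \in [fset i.2 | i in r]%fset].
    have [[w [Yw wk]]|noY] := pselect (exists w, vertices Y w /\ codeY w = k).
      have [//|//|r [isor qr wr]] := @partial_iso_extend _ _ _ snd fst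
        (fun w v => (v, w)) _ _ _ _ _ _ cY RX (partial_isoC isoq) Yw.
      exists r; split => //; first exact: partial_isoC.
      move=> w' Yw' w'k.
      suff -> : w' = w by [].
      by apply: codeY_inj; rewrite ?inE// wk.
    by exists q; split => // w Yw wk; exfalso; apply: noY; exists w.
  exists r => //; split => //; first exact: fsubset_trans qr.
  move=> v Xv vk; have /imfsetP[i /= iq ->] := qX v Xv vk.
  by apply: in_imfset; exact: (fsubsetP qr).
have umono k l i : (k <= l)%N -> i \in u k -> i \in u l.
  move=> kl ik; elim: l kl => [|l IH]; first by rewrite leqn0 => /eqP <-.
  rewrite leq_eqVlt => /orP[/eqP <- //|/IH il].
  by have [/fsubsetP sub _ _] := uS l; exact: sub.
have /choice[f fP] : forall v, exists w, vertices X v -> exists k, (v, w) \in u k.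
  move=> v; have [Xv|//] := pselect (vertices X v); last by exists point.
  have [_ /(_ v Xv erefl)/imfsetP[[v' w] /= iu ->] _] := uS (codeX v).
  by exists w => _; exists (codeX v).+1.
(* Any two pairs of the chain lie in a common stage, where injectivity is known. *)
have uinj k l i j : i \in u k -> j \in u l -> i.1 = j.1 <-> i.2 = j.2.
  move=> ik jl; have [_ uI _] := uiso (maxn k l); apply: uI.
    by apply: umono ik; rewrite leq_maxl.
  by apply: umono jl; rewrite leq_maxr.
exists f; split; first split.
- by move=> v /fP[k vk]; have [uV _ _] := uiso k; have [] := uV _ vk.
- move=> v v'; rewrite !inE => /fP[k vk] /fP[l v'l] ff.
  by have [_ /(_ ff)] := uinj _ _ _ _ vk v'l.
- move=> w Yw; have [_ _ /(_ w Yw erefl)/imfsetP[[v w'] /= iu ->]] := uS (codeY w).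
  have [uV _ _] := uiso (codeY w).+1; have [/= Xv _] := uV _ iu.
  exists v => //; have [k vk] := fP _ Xv.
  by have [/(_ erefl)] := uinj _ _ _ _ vk iu.
move=> s sX.
(* A finite [s] is matched entirely at one stage, the largest of the levels of its vertices. *)
have /choice[lev levP] : forall v, exists k, v \in s -> (v, f v) \in u k.
  move=> v; have [vs|_] := boolP (v \in s); last by exists 0.
  by have [k vk] := fP _ (sX _ vs); exists k.
have [_ _ /(_ [fset (v, f v) | v in s]%fset)] := uiso (\max_(v <- s) lev v).
rewrite -!imfset_comp imfset_id; apply.
apply/fsubsetP => _ /imfsetP[v /= vs ->].
by apply: umono (levP _ vs); exact: leq_bigmax_seq.
Qed.

Lemma rado_the_rado (V : pointedType) (X : set {fset V}) :
  is_rado X -> is_the_rado_complex X.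
Proof. by move=> RX; split => // W Y RY; exact: rado_isomorphic. Qed.

(** * Nowhere dense sets and Baire category in terms of truncations *)

Section category_in_Omega.
Context {R : realType}.
Implicit Types (X Y Z : Omega R) (F : set (Omega R)).

Local Open Scope ring_scope.

Lemma omega_dist_le X Y n : truncation X n = truncation Y n ->
  omega_dist X Y <= expR (- n%:R).
Proof.
move=> nXY; have [->|XY] := pselect (X = Y).
  by rewrite omega_distxx expR_ge0.
have [m [mE _ mmax]] := agreement_max XY; rewrite (omega_distE mE).
by rewrite ler_expR lerN2 ler_nat mmax.
Qed.

Lemma nbhs_truncationP X F : nbhs X F <->
  exists n, [set Y | truncation X n = truncation Y n] `<=` F.
Proof.
split=> [/nbhs_ballP[e /= e0 eF]|[n nF]].
  (* This [n] exceeds the inverse of [e], and exp(n) >= 1 + n, so exp(-n) < e. *)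
  exists (Num.truncn e^-1).+1 => Y /omega_dist_le XY; apply: eF.
  apply: (le_lt_trans XY); rewrite expRN -[ltRHS]invrK.
  rewrite ltf_pV2 ?posrE ?invr_gt0 ?expR_gt0//.
  rewrite (lt_le_trans (truncnS_gt _))//.
  by rewrite (le_trans _ (expR_ge1Dx _))// lerDr.
apply/nbhs_ballP; exists (expR (- n%:R)) => /=; first exact: expR_gt0.
move=> Y XY; apply: nF => /=; apply: contrapT => nXY.
have /omega_dist_ge : truncation X n.+1 <> truncation Y n.+1.
  by move/(truncation_le (leqnSn n)).
by rewrite leNgt XY.
Qed.

(** Nowhere density in terms of cylinders: each cylinder contains a smaller one disjoint from [F].
    The bound on [m] makes successive choices nested. *)
Definition avoidable F : Prop := forall X n, exists Y m,
  [/\ (n <= m)%N, truncation X n = truncation Y n &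
      forall Z, truncation Y m = truncation Z m -> ~ F Z].

Lemma sub_avoidable F G : F `<=` G -> avoidable G -> avoidable F.
Proof.
move=> FG aG X n; have [Y [m [nm XY YG]]] := aG X n.
by exists Y, m; split => // Z /YG nG /FG.
Qed.

Lemma avoidable_nowhere_dense F : avoidable F -> nowhere_dense F.
Proof.
move=> aF; rewrite /nowhere_dense -subset0 => X /nbhs_truncationP[n nF].
have [Y [m [_ XY YF]]] := aF X n.
have /(_ [set Z | truncation Y m = truncation Z m])[] := nF _ XY.
  by apply/nbhs_truncationP; exists m.
by move=> Z [FZ /YF].
Qed.

(* Baire's theorem for [Omega]: the point that escapes every [F k] is the union
   of an increasing sequence of truncations. *)
Lemma avoidable_dense (F : nat -> set (Omega R)) :
  (forall k, avoidable (F k)) -> dense (~` \bigcup_k F k).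
Proof.
move=> aF O [X0 OX0] oO.
have /nbhs_truncationP[n0 n0O] : nbhs X0 O by exact: open_nbhs_nbhs.
(* A pair [(X, n)] stands for the cylinder of complexes agreeing with [X] up to [n]; stage [k]
   shrinks it to one that misses [F k]. *)
have [||u [u0 _ uS]] := @dependent_choice_inv (Omega R * nat) (fun=> True)
    (fun k x y => [/\ (x.2 <= y.2)%N, truncation x.1 x.2 = truncation y.1 x.2 &
      forall Z, truncation y.1 y.2 = truncation Z y.2 -> ~ F k Z]) (X0, n0).
- by [].
- move=> k [X n] _; have [Y [m [nm XY YF]]] := aF k X n.
  by exists (Y, m).
have u2 k l : (k <= l)%N -> ((u k).2 <= (u l).2)%N.
  elim: l => [|l IH]; first by rewrite leqn0 => /eqP <-.
  rewrite leq_eqVlt => /orP[/eqP <- //|/IH kl].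
  by have [lS _ _] := uS l; exact: leq_trans kl lS.
have u1 k l : (k <= l)%N ->
    truncation (u k).1 (u k).2 = truncation (u l).1 (u k).2.
  elim: l => [|l IH]; first by rewrite leqn0 => /eqP <-.
  rewrite leq_eqVlt => /orP[/eqP <- //|kl]; rewrite IH//.
  by have [_ lS _] := uS l; apply: truncation_le lS; exact: u2.
pose L : set {fset nat} := \bigcup_k truncation (u k).1 (u k).2.
have LP : subcomplex L DeltaN.
  split; last by move=> s [k _ [/((simplexesP _).2)]].
  split=> [s [k _ [/((simplexesP (u k).1).1.1)]]//|s t [k _ [us [s0 sD]]] ts t0].
  exists k => //; split; first exact: (simplexesP (u k).1).1.2 us ts t0.
  by split => // v /(fsubsetP ts)/sD.
pose Z := MkOmega R LP.
have ZE k : truncation (u k).1 (u k).2 = truncation Z (u k).2.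
  apply/seteqP; split=> [s us|s [[l _ us] sD]].
    by split; [exists k|case: us].
  have [kl|/ltnW lk] := leqP k l.
    by rewrite (u1 _ _ kl); split => //; case: us.
  by split => //; move: us; rewrite (u1 _ _ lk) => -[].
exists Z; split; first by apply: n0O; have /= := ZE 0; rewrite u0.
by move=> [k _]; have [_ _ kF] := uS k; apply: kF; exact: ZE.
Qed.

End category_in_Omega.

(** * Unsolved extension problems *)

Section rado_residual.
Context {R : realType}.
Implicit Types X Y Z : Omega R.

(** Taking [U] and [A] as finite sets of a countable type makes the problems enumerable. *)
Definition bad_extension (U : {fset nat}) (A : {fset {fset nat}}) :
    set (Omega R) :=
  [set X | [/\ [set` U] `<=` vertices X,
    subcomplex [set` A] (induced_subcomplex X [set` U]) &
    ~ exists v, [/\ vertices X v, ~ [set` U] v &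
        link X v `&` induced_subcomplex X [set` U] = [set` A]]]].

(** Only the extension property can fail: countability is automatic, and the problem with [U] and
    [A] empty already yields a vertex. Moreover [A] is finite, since its simplexes are subsets of
    [U]. *)
Lemma not_rado_bad X : ~ is_rado (simplexes X) -> exists U A, bad_extension U A X.
Proof.
move=> nR; apply: contrapT => noBad; apply: nR.
have ext (U : set nat) (A : set {fset nat}) : finite_set U ->
    U `<=` vertices X -> subcomplex A (induced_subcomplex X U) ->
    exists v, [/\ vertices X v, ~ U v & link X v `&` induced_subcomplex X U = A].
  move=> finU UX AX; apply: contrapT => no; apply: noBad.
  have finA : finite_set A.
    apply: sub_finite_set (finite_fset (fpowerset (fset_set U))) => s As.
    rewrite /= fpowersetE; apply/fsubsetP => v vs.
    by have [_ [_ /(_ v vs) Uv]] := AX.2 _ As; rewrite in_fset_set// inE.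
  by exists (fset_set U), (fset_set A); rewrite /bad_extension !fset_setK.
have [cX _] := simplexesP X; split => //; first exact: countableP.
have [|||v [Xv _ _]] := ext set0 set0.
- exact: finite_set0.
- by [].
- by split.
by exists [fset v]%fset.
Qed.

Lemma truncation_simplex X Y n (s : {fset nat}) :
  truncation X n = truncation Y n -> {in s, forall v, (v <= n)%N} ->
  simplexes X s <-> simplexes Y s.
Proof.
have half X' Y' : truncation X' n = truncation Y' n ->
    {in s, forall v, (v <= n)%N} ->
    simplexes X' s -> simplexes Y' s.
  move=> XY sn Xs; have [s0 sN] := (simplexesP X').2 _ Xs.
  suff : truncation Y' n s by case.
  rewrite -XY; split => //; split => // v vs /=.
  by rewrite (sn _ vs) andbT; exact: sN.
by move=> XY sn; split; exact: half.
Qed.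

(* Adding one vertex [w] beyond the truncation level, whose link is [A], settles
   the extension problem [(U, A)] for every complex that agrees up to [w]. *)
Lemma bad_extension_avoidable U A : avoidable (bad_extension U A).
Proof.
move=> X n; pose N := maxn n (\max_(v <- U) v).
have nN : (n <= N)%N by rewrite leq_maxl.
have UN v : v \in U -> (v <= N)%N.
  by move=> vU; rewrite leq_max (@leq_bigmax_seq _ _ _ (fun v => v)) ?orbT.
(* Whether the problem is posed in a complex depends only on simplexes with vertices up to [N]; if
   it is not posed in [X], the cylinder of [X] at level [N] already avoids it. *)
have [[UX AX]|nX] := pselect ([set` U] `<=` vertices X /\
    subcomplex [set` A] (induced_subcomplex X [set` U])); last first.
  exists X, N; split => // Z XZ [UZ [cA AZ] _]; apply: nX; split=> [v vU|].
    apply/(truncation_simplex XZ); last exact: UZ.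
    by move=> x; rewrite inE => /eqP ->; exact: UN.
  split => // s As; have [Zs [s0 sU]] := AZ _ As; split => //.
  by apply/(truncation_simplex XZ) => // v /sU/UN.
pose w := N.+1.
have wNN (s : {fset nat}) : {in s, forall v, (v <= N)%N} -> w \notin s.
  by move=> sN; apply/negP => /sN; rewrite ltnn.
have AN s : s \in A -> {in s, forall v, (v <= N)%N}.
  by move=> /AX.2[_ [_ sU]] v /sU/UN.
(* The truncation of [X] at [N] together with the cone over [A] with apex [w]; the case of an empty
   remainder provides the apex itself. *)
pose L : set {fset nat} := [set s | s != fset0 /\
  if w \in s then (s `\ w)%fset = fset0 \/ (s `\ w)%fset \in A
  else truncation X N s].
have AL s : s \in A -> L s.
  move=> As; split; first exact: AX.1.1 As.
  rewrite (negbTE (wNN _ (AN _ As))); split; first by have [] := AX.2 _ As.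
  have [Xs _] := AX.2 _ As; have [s0 sN] := (simplexesP X).2 _ Xs.
  by split => // v vs /=; rewrite (AN _ As _ vs) andbT; exact: sN.
have LP : subcomplex L DeltaN.
  split; last first.
    move=> s [s0]; case: ifPn => [ws sA|_ [/((simplexesP X).2)//]].
    split => // v vs /=; have [->//|vw] := eqVneq v w.
    have vsw : v \in (s `\ w)%fset by rewrite !inE vw.
    case: sA => [s'0|/AX.2[Xs _]]; first by rewrite s'0 in vsw.
    by have [_ sN] := (simplexesP X).2 _ Xs; exact: sN.
  split=> [s []//|s t [s0 Ls] ts t0]; split => //.
  have [wt|wt] := ifPn.
    move: Ls; rewrite (fsubsetP ts _ wt) => Ls.
    have [->|tw0] := eqVneq (t `\ w)%fset fset0; [by left|right].
    have tsw : (t `\ w `<=` s `\ w)%fset by exact: fsetSD.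
    case: Ls => [sw0|sA]; first by rewrite sw0 fsubset0 (negbTE tw0) in tsw.
    exact: (AX.1.2 _ _ sA tsw tw0).
  move: Ls; case: ifPn => [ws Ls|ws [Xs [_ sN]]]; last first.
    split; first exact: (simplexesP X).1.2 Xs ts t0.
    by split => // v /(fsubsetP ts)/sN.
  have tsw : (t `<=` s `\ w)%fset by rewrite fsubsetD1 ts.
  case: Ls => [sw0|sA]; first by rewrite sw0 fsubset0 (negbTE t0) in tsw.
  by have [_] := AL _ (AX.1.2 _ _ sA tsw t0); rewrite (negbTE wt).
pose Y := MkOmega R LP.
exists Y, w; split; first exact: leqW.
  apply: (truncation_le nN); apply/seteqP; split=> s [Xs sN]; split => //.
    split; first by case: sN.
    by rewrite (negbTE (wNN _ _))// => v /sN.2/andP[].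
  case: Xs => _; rewrite (negbTE (wNN _ _)) => [[]//|].
  by move=> v /sN.2/andP[].
move=> Z YZ [UZ AZ]; apply; exists w.
have leW (s : {fset nat}) : {in s, forall v, (v <= N)%N} ->
    {in (w |` s)%fset, forall v, (v <= w)%N}.
  by move=> sN v; rewrite !inE => /orP[/eqP -> //|/sN/leqW].
split.
- apply/(truncation_simplex YZ); first by move=> v; rewrite inE => /eqP ->.
  split; first by apply/fset0Pn; exists w; rewrite inE.
  by rewrite inE eqxx; left; rewrite fsetDv.
- by move/UN; rewrite ltnn.
apply/seteqP; split=> [s [[Zs ws Zws] [_ [s0 sU]]]|s sA].
  have sN : {in s, forall v, (v <= N)%N} by move=> v /sU/UN.
  have [_] := (truncation_simplex YZ (leW _ sN)).2 Zws.
  rewrite !inE eqxx /= fsetU1K// => -[s00|//].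
  by rewrite s00 eqxx in s0.
have sN := AN _ sA; have ws := wNN _ sN.
split; last exact: AZ.2.
split => //; first by have [] := AZ.2 _ sA.
apply/(truncation_simplex YZ (leW _ sN)); split.
  by apply/fset0Pn; exists w; rewrite !inE eqxx.
by rewrite !inE eqxx /= fsetU1K//; right.
Qed.

End rado_residual.

(** * Countable union over all extension problems *)

Theorem theorem11p1 (R : realType) :
  residual (rado_class R) /\ dense (rado_class R).
Proof.
(* The problems are enumerated by their codes; a number that codes none gets the empty set. *)
pose F k : set (Omega R) :=
  if @choice.unpickle ({fset nat} * {fset {fset nat}})%type k is Some (U, A)
  then bad_extension U A else set0.
have aF k : avoidable (F k).
  rewrite /F; case: choice.unpickle => [[U A]|]; first exact: bad_extension_avoidable.
  by move=> X n; exists X, n; split => // Z _ [].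
have FP : ~` rado_class R `<=` \bigcup_k F k.
  move=> X nX; have [|U [A UA]] := @not_rado_bad R X.
    move=> /rado_the_rado RX; apply: nX; exists nat, (simplexes X); split => //.
    exact: RX.2 RX.1.
  by exists (choice.pickle (U, A)) => //; rewrite /F choice.pickleK.
split.
  (* Residuality asks for equality with the complement. Removing [rado_class R] from each set gives
     it without having to transport the extension property along isomorphisms. *)
  exists (fun k => F k `\` rado_class R); split.
    move=> k; apply: avoidable_nowhere_dense.
    by apply: sub_avoidable (aF k); exact: subDsetl.
  by rewrite -setD_bigcupl; apply/seteqP; split=> [X nX|X []//]; split => //; exact: FP.
move=> O O0 oO; have [X [OX FX]] := avoidable_dense aF O0 oO.
by exists X; split => //; apply: contrapT => /FP.
Qed.
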